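(* In the setting described in the context, let $t\in\{0,1,\dots,T-1\}$. Among all probability distributions $\mathbf p_t$ on $[n]$ with all entries positive, the coherence parameter $$\nu_{k,T}(t)=\max_{i\in[n],\,j\in[k]}\frac{|\tilde{\mathbf U}_{tn+i,\,j}|}{\sqrt{\mathbf p_t(i)}}$$ is minimized when $$\mathbf p_t(i)=\frac{|\tilde{\mathbf U}_{tn+i,\,\kappa_i}|^2}{\sum_{j=1}^n|\tilde{\mathbf U}_{tn+j,\,\kappa_j}|^2},\qquad i\in[n],$$ where $\kappa_i\in\arg\max_{m\in[k]}|\tilde{\mathbf U}_{tn+i,\,m}|$ for $i\in[n]$. In this case, $$\big(\nu_{k,T}(t)\big)^2=\sum_{j=1}^n|\tilde{\mathbf U}_{tn+j,\,\kappa_j}|^2.$$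
   Context: Write $[n]=\{1,\dots,n\}$. Graph and diffusion. $\mathcal G$ is a weighted undirected connected graph on $n$ vertices with symmetric weighted adjacency matrix (entries $w_{ij}>0$ on edges and $0$ otherwise), degree matrix $\mathbf D$ and Laplacian $\mathbf L=\mathbf D-(w_{ij})_{i,j}$. All eigenvalues of $\mathbf L$ are assumed simple: $0=\sigma_1<\sigma_2<\dots<\sigma_n$, with orthonormal (real) eigenvectors $\mathbf u_1,\dots,\mathbf u_n$. Fix $\Delta t>0$; the evolution operator is $\mathbf A=e^{-\Delta t\,\mathbf L}$, with eigenvalues $\lambda_i=e^{-\Delta t\,\sigma_i}$. Space-time matrix. Let $1\le k\le n$ and $T\ge1$ be integers and $f_T(\lambda)=\big(\sum_{j=0}^{T-1}\lambda^{2j}\big)^{1/2}$. The matrix $\tilde{\mathbf U}=\tilde{\mathbf U}_{k,T}\in\mathbb R^{Tn\times k}$ has entries $$\tilde{\mathbf U}_{tn+i,\,j}=\frac{\lambda_j^t}{f_T(\lambda_j)}\,\mathbf u_j(i),\qquad t=0,\dots,T-1,\ i\in[n],\ j\in[k].$$ *)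

(* Defs.v *)
From HB Require Import structures.
From mathcomp Require Import all_boot all_order all_algebra.
From mathcomp Require Import reals sequences exp.
Set Implicit Arguments.
Unset Strict Implicit.
Unset Printing Implicit Defensive.
Import Order.TTheory GRing.Theory Num.Theory.
Local Open Scope ring_scope.

Section Graph.
Context {R : realType} {n : nat}.

(* Self-loops are neither required nor excluded; they cancel in [laplacian]. *)
Definition weighted_graph (e : rel 'I_n) (w : 'M[R]_n) : Prop :=
  [/\ symmetric e, w^T = w,
      forall i j, e i j -> 0 < w i j &
      forall i j, ~~ e i j -> w i j = 0].

Definition connected_graph (e : rel 'I_n) : Prop := forall i j, connect e i j.

Definition degree_mx (w : 'M[R]_n) : 'M[R]_n := diag_mx (\row_i \sum_j w i j).

Definition laplacian (w : 'M[R]_n) : 'M[R]_n := degree_mx w - w.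

(* Indices start at 0, so the eigenvalue required to vanish is the one of
   index 0. The [n] orthonormal eigenvectors and the strict monotonicity of
   [sigma] make [sigma] the whole spectrum, every eigenvalue being simple. *)
Definition simple_eigensystem (L : 'M[R]_n)
    (sigma : 'I_n -> R) (u : 'I_n -> 'cV[R]_n) : Prop :=
  [/\ forall i : 'I_n, i = 0%N :> nat -> sigma i = 0,
      forall i j : 'I_n, (i < j)%N -> sigma i < sigma j,
      forall i, L *m u i = sigma i *: u i &
      forall i j, (u i)^T *m u j = ((i == j)%:R)%:M].

End Graph.

Section SpaceTimeIndex.
Context {T n : nat}.

Lemma st_index_subproof (t : 'I_T) (i : 'I_n) : (t * n + i < T * n)%N.
Proof.
apply: (@leq_trans (t.+1 * n)); first by rewrite mulSn addnC ltn_add2r.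
by rewrite leq_mul2r ltn_ord orbT.
Qed.

Definition st_index (t : 'I_T) (i : 'I_n) : 'I_(T * n) :=
  Ordinal (st_index_subproof t i).

Lemma st_gt0 (r : 'I_(T * n)) : (0 < n)%N.
Proof. by case: n r => // -[r]; rewrite muln0. Qed.

Lemma st_time_subproof (r : 'I_(T * n)) : (r %/ n < T)%N.
Proof. by rewrite ltn_divLR ?(st_gt0 r). Qed.

Lemma st_vertex_subproof (r : 'I_(T * n)) : (r %% n < n)%N.
Proof. by rewrite ltn_pmod ?(st_gt0 r). Qed.

Definition st_time (r : 'I_(T * n)) : 'I_T := Ordinal (st_time_subproof r).
Definition st_vertex (r : 'I_(T * n)) : 'I_n := Ordinal (st_vertex_subproof r).

Lemma st_indexK1 t i : st_time (st_index t i) = t.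
Proof.
have n_gt0 : (0 < n)%N by exact: leq_ltn_trans (leq0n i) (ltn_ord i).
by apply: val_inj; rewrite /= divnMDl // divn_small ?addn0.
Qed.

Lemma st_indexK2 t i : st_vertex (st_index t i) = i.
Proof. by apply: val_inj; rewrite /= modnMDl modn_small. Qed.

End SpaceTimeIndex.

Section SpaceTime.
Context {R : realType} {n k T : nat}.

(* Eigenvalue of the evolution operator exp (- dt L). *)
Definition evolution_eigenvalue (dt : R) (sigma : 'I_n -> R) (j : 'I_n) : R :=
  expR (- dt * sigma j).

Definition fT (l : R) : R := Num.sqrt (\sum_(s < T) l ^+ (2 * s)).

Definition space_time_mx (hk : (k <= n)%N) (dt : R)
    (sigma : 'I_n -> R) (u : 'I_n -> 'cV[R]_n) : 'M[R]_(T * n, k) :=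
  \matrix_(r, j)
    let l := evolution_eigenvalue dt sigma (widen_ord hk j) in
    l ^+ st_time r / fT l * u (widen_ord hk j) (st_vertex r) 0.

Lemma space_time_mxE hk dt sigma u (t : 'I_T) (i : 'I_n) (j : 'I_k) :
  space_time_mx hk dt sigma u (st_index t i) j =
  evolution_eigenvalue dt sigma (widen_ord hk j) ^+ t
    / fT (evolution_eigenvalue dt sigma (widen_ord hk j))
    * u (widen_ord hk j) i 0.
Proof. by rewrite mxE st_indexK1 st_indexK2. Qed.

Definition positive_distribution (p : 'I_n -> R) : Prop :=
  (forall i, 0 < p i) /\ \sum_i p i = 1.

(* The terms are nonnegative, so the default value 0 does not affect the
   maximum as soon as [n] and [k] are positive. *)
Definition coherence (U : 'M[R]_(T * n, k)) (t : 'I_T) (p : 'I_n -> R) : R :=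
  \big[Num.max/0]_(i < n) \big[Num.max/0]_(j < k)
    (`|U (st_index t i) j| / Num.sqrt (p i)).

Definition is_argmax (m : 'I_k) (f : 'I_k -> R) : Prop := forall j, f j <= f m.

Definition peak_sum (U : 'M[R]_(T * n, k)) (t : 'I_T) (kappa : 'I_n -> 'I_k) : R :=
  \sum_(j < n) `|U (st_index t j) (kappa j)| ^+ 2.

Definition peak_distribution (U : 'M[R]_(T * n, k)) (t : 'I_T)
    (kappa : 'I_n -> 'I_k) (i : 'I_n) : R :=
  `|U (st_index t i) (kappa i)| ^+ 2 / peak_sum U t kappa.

End SpaceTime.

Arguments fT {R} T l.
Arguments space_time_mx {R n k} T hk dt sigma u.

(* Main.v *)
(** The vector [u_0] is harmonic, so by the maximum principle on a connected
    graph it is a nonzero constant; hence each row of the space-time matrix has a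
    nonzero entry and the peaks [a_i = |U_(tn+i, kappa_i)|] are positive. If [c]
    is the coherence of a distribution [p], then [a_i^2 <= c^2 p_i] for all [i],
    and summing over [i] gives [sum_i a_i^2 <= c^2]. When [p_i] is proportional
    to [a_i^2], all the quotients [a_i / sqrt p_i] equal the square root of
    [sum_i a_i^2], so this bound is attained. *)

Require Import Defs.
From HB Require Import structures.
From mathcomp Require Import all_boot all_order all_algebra.
From mathcomp Require Import reals sequences exp.
Set Implicit Arguments.
Unset Strict Implicit.
Unset Printing Implicit Defensive.
Import Order.TTheory GRing.Theory Num.Theory.
Local Open Scope ring_scope.

Section Laplacian.
Context {R : realType} {n : nat}.
Implicit Types (w : 'M[R]_n) (x : 'cV[R]_n) (e : rel 'I_n).

(** In this difference form every summand is nonnegative when [x] is maximal at [i]. *)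
Lemma laplacian_mulE w x i :
  (laplacian w *m x) i 0 = \sum_j w i j * (x i 0 - x j 0).
Proof.
rewrite mulmxBl mul_diag_mx !mxE mulr_suml -sumrB.
by apply: eq_bigr => j _; rewrite mulrBr.
Qed.

Lemma harmonic_const e w x i j :
  weighted_graph e w -> connected_graph e -> laplacian w *m x = 0 ->
  x i 0 = x j 0.
Proof.
move=> [_ _ w_gt0 w_eq0] conn_e Lx0.
pose m := [arg max_(l > i) x l 0]%O.
have le_m l : x l 0 <= x m 0 by rewrite /m; case: arg_maxP => // a _; apply.
have w_ge0 a b : 0 <= w a b.
  by have [/w_gt0/ltW|/w_eq0 ->] := boolP (e a b).
(* At a maximal vertex the nonnegative summands add up to 0, so each vanishes; a positive weight
   then passes the maximum on to the neighbour. *)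
have maxS a b : e a b -> x a 0 = x m 0 -> x b 0 = x m 0.
  move=> eab xa.
  have /eqP : \sum_c w a c * (x a 0 - x c 0) = 0.
    by rewrite -laplacian_mulE Lx0 mxE.
  rewrite psumr_eq0; last by move=> c _; rewrite mulr_ge0 // xa subr_ge0.
  move=> /allP /(_ b (mem_index_enum b)) /=.
  by rewrite mulf_eq0 gt_eqF ?w_gt0 //= subr_eq0 xa => /eqP.
have maxE l : x l 0 = x m 0.
  have /connectP [p] := conn_e m l.
  have: x m 0 = x m 0 by [].
  (* Only the start of the path is generalized; the maximal value [x m 0] stays fixed. *)
  elim: p {1 3 4}m => [|b p IHp] a xa /=; first by move=> _ ->.
  by move=> /andP [/maxS/(_ xa) /IHp]; apply.
by rewrite !maxE.
Qed.

(** One zero entry would make the constant vector [u z] vanish, against its unit norm. *)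
Lemma ground_state_neq0 e w sigma (u : 'I_n -> 'cV[R]_n) (z i : 'I_n) :
  weighted_graph e w -> connected_graph e ->
  simple_eigensystem (laplacian w) sigma u -> z = 0%N :> nat ->
  u z i 0 != 0.
Proof.
move=> hG conn_e [sigma0 _ eig_u on_u] z0.
have Lu0 : laplacian w *m u z = 0 by rewrite eig_u sigma0 // scale0r.
apply/eqP => uzi0.
have uz0 : u z = 0.
  by apply/colP => j; rewrite (harmonic_const j i hG conn_e Lu0) uzi0 mxE.
move: (on_u z z); rewrite uz0 mulmx0 eqxx => /matrixP /(_ 0 0) /esym/eqP.
by rewrite !mxE eqxx oner_eq0.
Qed.

End Laplacian.

(** The term [s = 0] equals 1 and the others are squares. *)
Lemma fT_gt0 (R : realType) (T : nat) (l : R) : (0 < T)%N -> 0 < fT T l.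
Proof.
case: T => // T _; rewrite sqrtr_gt0 big_ord_recl muln0 expr0.
by rewrite ltr_pwDl // sumr_ge0 // => s _; rewrite mulnC exprM sqr_ge0.
Qed.

Section Coherence.
Context {R : realType} {n k T : nat}.
Variables (U : 'M[R]_(T * n, k)) (t : 'I_T).
Implicit Types (p : 'I_n -> R) (kappa : 'I_n -> 'I_k).

Lemma coherence_ge0 p : 0 <= coherence U t p.
Proof. exact: bigmax_ge_id. Qed.

Lemma ler_coherence p i j :
  `|U (st_index t i) j| / Num.sqrt (p i) <= coherence U t p.
Proof.
by apply: (bigmax_sup i) => //; apply: (bigmax_sup j).
Qed.

(** The condition [0 <= c] covers the default value 0 of the iterated maxima. *)
Lemma coherence_ler p c : 0 <= c ->
  (forall i j, `|U (st_index t i) j| / Num.sqrt (p i) <= c) ->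
  coherence U t p <= c.
Proof. by move=> c0 le_c; do 2![apply: bigmax_le => // ? _]. Qed.

Lemma peak_sum_le_coherence p kappa :
  positive_distribution p -> peak_sum U t kappa <= coherence U t p ^+ 2.
Proof.
move=> [p_gt0 p1]; rewrite -[leRHS]mulr1 -p1 mulr_sumr.
apply: ler_sum => i _.
(* Both sides become squares of nonnegative numbers, which reduces the bound to a single quotient in
   the maximum. *)
rewrite -(sqr_sqrtr (ltW (p_gt0 i))) -exprMn ler_sqr ?nnegrE //; last first.
  by rewrite mulr_ge0 ?coherence_ge0 ?sqrtr_ge0.
by rewrite -ler_pdivrMr ?sqrtr_gt0 // ler_coherence.
Qed.

Section PositivePeaks.
Variable kappa : 'I_n -> 'I_k.
Hypothesis n_gt0 : (0 < n)%N.
Hypothesis peak_gt0 : forall i, 0 < `|U (st_index t i) (kappa i)|.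

Lemma peak_sum_gt0 : 0 < peak_sum U t kappa.
Proof.
rewrite /peak_sum (bigD1 (Ordinal n_gt0)) //= ltr_pwDl ?exprn_gt0 //.
by rewrite sumr_ge0 // => i _; rewrite exprn_ge0.
Qed.

Lemma peak_distribution_positive :
  positive_distribution (peak_distribution U t kappa).
Proof.
split=> [i|]; first by rewrite divr_gt0 ?exprn_gt0 ?peak_sum_gt0.
by rewrite -mulr_suml divff // gt_eqF ?peak_sum_gt0.
Qed.

Lemma coherence_peak_distribution :
  (forall i, is_argmax (kappa i) (fun m => `|U (st_index t i) m|)) ->
  coherence U t (peak_distribution U t kappa) = Num.sqrt (peak_sum U t kappa).
Proof.
move=> kappa_max; apply/eqP; rewrite eq_le; apply/andP; split.
  apply: coherence_ler => [|i j]; first exact: sqrtr_ge0.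
  (* The quotient becomes the ratio of entry [j] to the peak of row [i], at most 1, times the root
     of the peak sum. *)
  rewrite /peak_distribution sqrtrM ?exprn_ge0 // sqrtr_sqr normr_id.
  rewrite sqrtrV ?(ltW peak_sum_gt0) // invfM invrK mulrA.
  by rewrite ler_piMl ?sqrtr_ge0 // ler_pdivrMr ?mul1r ?kappa_max.
rewrite -[leRHS]ger0_norm ?coherence_ge0 // -sqrtr_sqr ler_wsqrtr //.
exact: peak_sum_le_coherence peak_distribution_positive.
Qed.

End PositivePeaks.
End Coherence.

Theorem proposition5 (R : realType) (n k T : nat)
    (e : rel 'I_n) (w : 'M[R]_n)
    (sigma : 'I_n -> R) (u : 'I_n -> 'cV[R]_n) (dt : R)
    (hG : weighted_graph e w) (hconn : connected_graph e)
    (hspec : simple_eigensystem (laplacian w) sigma u)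
    (hdt : 0 < dt)
    (hk1 : (1 <= k)%N) (hkn : (k <= n)%N) (hT : (1 <= T)%N)
    (t : 'I_T) (kappa : 'I_n -> 'I_k) :
  let U := space_time_mx T hkn dt sigma u in
  (forall i : 'I_n, is_argmax (kappa i) (fun m => `|U (st_index t i) m|)) ->
  let pstar := peak_distribution U t kappa in
  [/\ positive_distribution pstar,
      forall p : 'I_n -> R, positive_distribution p ->
        coherence U t pstar <= coherence U t p &
      (coherence U t pstar) ^+ 2 =
        \sum_(j < n) `|U (st_index t j) (kappa j)| ^+ 2].
Proof.
move=> U kappa_max pstar.
have n_gt0 : (0 < n)%N := leq_trans hk1 hkn.
have peak_gt0 i : 0 < `|U (st_index t i) (kappa i)|.
  (* The peak dominates the entry in column 0, which comes from the ground state. *)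
  apply: lt_le_trans (kappa_max i (Ordinal hk1)).
  rewrite normr_gt0 /U space_time_mxE mulf_neq0 //.
    by rewrite mulf_neq0 ?invr_eq0 ?expf_neq0 // gt_eqF ?expR_gt0 ?fT_gt0.
  exact: ground_state_neq0 hG hconn hspec _.
have cohE := coherence_peak_distribution n_gt0 peak_gt0 kappa_max.
split=> [|p p_dist|]; first exact: peak_distribution_positive.
  rewrite cohE -[leRHS]ger0_norm ?coherence_ge0 // -sqrtr_sqr ler_wsqrtr //.
  exact: peak_sum_le_coherence.
by rewrite cohE sqr_sqrtr // ltW ?peak_sum_gt0.
Qed.
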